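(* Let $(X,Y)$ be a random pair with $X$ in a measurable space $\mathcal{X}$ and $Y\in\{-1,+1\}$, let $P_X$ be the law of $X$ and $\eta(x)=\mathbb{P}(Y=+1\mid X=x)$. Let $\mathscr{D}$ be the set of measurable score rules $f:\mathcal{X}\to\mathbb{R}$, and let $\mathcal{O}$ be Bayes optimality in the pointwise posterior sense: for a margin loss $L(y,t)=\phi(yt)$, $f\in\mathcal{O}(L)$ iff $f(x)$ minimizes over $\alpha\in\mathbb{R}$ the conditional risk $C_{\eta(x)}(\alpha)=\eta(x)\phi(\alpha)+(1-\eta(x))\phi(-\alpha)$ for $P_X$-a.e. $x$. Assume that $\eta(X)\in(0,1)$ $P_X$-almost surely and that $P_X(\eta(X)\in U)>0$ for every nonempty open interval $U\subseteq(0,1)$. Then $\{\mathcal{L}_\lambda:\lambda\in\Lambda\}$ is a realizable exclusivity partition of $\mathscr{L}_{\mathrm{margin}}$ under $\mathcal{O}$.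
   Context: A margin loss $L(y,t)=\phi(yt)$ ($y\in\{-1,+1\}$, $t\in\mathbb{R}$) is called regular if $\phi:\mathbb{R}\to[0,\infty)$ is convex, continuously differentiable and strictly decreasing, and the margin invariant $H_\phi(t):=\phi'(-t)/\phi'(t)$ is well-defined, continuous, strictly increasing and surjective from $\mathbb{R}$ onto $(0,\infty)$. $\mathscr{L}_{\mathrm{margin}}$ is the set of all regular margin losses. The index set is $\Lambda:=\{H_\phi: \phi \text{ generates a loss in }\mathscr{L}_{\mathrm{margin}}\}$, and for $\lambda\in\Lambda$, $\mathcal{L}_\lambda:=\{L(y,t)=\phi(yt)\in\mathscr{L}_{\mathrm{margin}}: H_\phi=\lambda\}$. Exclusivity notions, for an ambient family $\mathcal{M}$ of losses (here $\mathcal{M}=\mathscr{L}_{\mathrm{margin}}$) and an optimality operator $\mathcal{O}$ assigning to each loss $L$ a subset $\mathcal{O}(L)\subseteq\mathscr{D}$: a subset $\mathcal{C}\subseteq\mathcal{M}$ is an exclusivity region within $\mathcal{M}$ if no $\delta\in\mathscr{D}$ belongs to $\mathcal{O}(L)$ for some $L\in\mathcal{C}$ and also to $\mathcal{O}(L')$ for some $L'\in\mathcal{M}\setminus\mathcal{C}$. A family $\{\mathcal{C}_i\}_{i\in I}$ of subsets of $\mathcal{M}$ is an exclusivity partition of $\mathcal{M}$ under $\mathcal{O}$ if the $\mathcal{C}_i$ are pairwise disjoint and each is an exclusivity region within $\mathcal{M}$. It is realizable if for every $i$ there are $L\in\mathcal{C}_i$ and $\delta\in\mathscr{D}$ with $\delta\in\mathcal{O}(L)$.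 *)

(* Defs.v *)
From HB Require Import structures.
From mathcomp Require Import all_boot all_order all_algebra.
From mathcomp Require Import all_classical all_reals all_analysis.
Import Order.TTheory GRing.Theory Num.Theory.
Import numFieldNormedType.Exports.

Set Implicit Arguments.
Unset Strict Implicit.
Unset Printing Implicit Defensive.

Local Open Scope classical_set_scope.
Local Open Scope ring_scope.

(* The label set {-1, +1} is encoded by bool: true is +1 and false is -1. *)
Definition label : Type := bool.
Definition label_val (R : realType) (y : label) : R := if y then 1 else -1.

Definition loss (R : realType) : Type := label -> R -> R.

Definition margin_loss (R : realType) (phi : R -> R) : loss R :=
  fun y t => phi (label_val R y * t).

(* Only meaningful when the derivative of phi never vanishes, since division
   is total; [regular_margin] requires this separately. *)
Definition margin_invariant (R : realType) (phi : R -> R) : R -> R :=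
  fun t => derive1 phi (- t) / derive1 phi t.

Record regular_margin (R : realType) (phi : R -> R) : Prop := RegularMargin {
  regular_ge0 : forall t, 0 <= phi t;
  regular_convex : convex_function (E := R^o) setT (phi : R^o -> R^o);
  regular_derivable : forall t, derivable phi t 1;
  regular_derive_continuous : continuous (derive1 phi);
  regular_decreasing : forall s t, s < t -> phi t < phi s;
  regular_invariant_defined : forall t, derive1 phi t != 0;
  regular_invariant_continuous : continuous (margin_invariant phi);
  regular_invariant_increasing :
    forall s t, s < t -> margin_invariant phi s < margin_invariant phi t;
  regular_invariant_range : range (margin_invariant phi) = [set u | 0 < u] }.

Definition margin_losses (R : realType) : set (loss R) :=
  [set L | exists2 phi, regular_margin phi & L = margin_loss phi].
Arguments margin_losses R : clear implicits.

Definition invariant_index (R : realType) : set (R -> R) :=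
  [set lam | exists2 phi : R -> R,
     regular_margin phi & margin_invariant phi = lam].
Arguments invariant_index R : clear implicits.

Definition margin_losses_of (R : realType) (lam : R -> R) : set (loss R) :=
  [set L | exists phi : R -> R,
     [/\ regular_margin phi, L = margin_loss phi & margin_invariant phi = lam]].
Arguments margin_losses_of R lam : clear implicits.

Section Exclusivity.
Variables (Loss Rule I : Type).

Definition exclusivity_region (M : set Loss) (O : Loss -> set Rule)
    (C : set Loss) : Prop :=
  C `<=` M /\
  ~ exists delta : Rule,
      (exists2 L, C L & O L delta) /\ (exists2 L', (M `\` C) L' & O L' delta).

(* The cells need not cover M. *)
Definition exclusivity_partition (M : set Loss) (O : Loss -> set Rule)
    (J : set I) (C : I -> set Loss) : Prop :=
  trivIset J C /\ forall i, J i -> exclusivity_region M O (C i).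

Definition realizable (O : Loss -> set Rule) (J : set I) (C : I -> set Loss)
    : Prop :=
  forall i, J i -> exists2 L, C i L & exists delta : Rule, O L delta.

End Exclusivity.

(* eta is a version of x |-> P(Y = +1 | X = x): P(X \in A, Y = +1) is the
   integral of eta over A with respect to the law of X. *)
Definition is_posterior d d' (Omega : measurableType d) (T : measurableType d')
    (R : realType) (P : probability Omega R) (X : {mfun Omega >-> T})
    (Y : {mfun Omega >-> bool}) (eta : T -> R) : Prop :=
  [/\ measurable_fun setT eta,
      (distribution P X).-integrable setT (EFin \o eta) &
      forall A : set T, measurable A ->
        P (X @^-1` A `&` Y @^-1` [set true]) =
        (\int[distribution P X]_(x in A) (eta x)%:E)%E].

Definition cond_risk (R : realType) (L : loss R) (p alpha : R) : R :=
  p * L true alpha + (1 - p) * L false alpha.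

Lemma cond_risk_margin (R : realType) (phi : R -> R) (p alpha : R) :
  cond_risk (margin_loss phi) p alpha = p * phi alpha + (1 - p) * phi (- alpha).
Proof. by rewrite /cond_risk /margin_loss /label_val mul1r mulN1r. Qed.

Definition bayes_optimal d (T : measurableType d) (R : realType)
    (PX : {measure set T -> \bar R}) (eta : T -> R) (L : loss R)
    : set {mfun T >-> R} :=
  [set f | {ae PX, forall x, forall alpha,
     cond_risk L (eta x) (f x) <= cond_risk L (eta x) alpha}].

(* Main.v *)
(* By convexity, a minimizes the conditional risk at p exactly when
   H_phi(a) = p / (1 - p), so a Bayes rule f for phi satisfies
   H_phi(f(x)) = odds(eta(x)) almost everywhere.  If f is also Bayes for psi and
   H_phi(t) < H_psi(t), then odds(eta(x)) lies in ]H_phi(t), H_psi(t)[ with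
   positive probability, and H_phi(f(x)) = odds(eta(x)) = H_psi(f(x)) forces
   t < f(x) < t.  Conversely, H_phi^-1 o odds o eta is a Bayes rule for phi. *)
Require Import Defs.
From HB Require Import structures.
From mathcomp Require Import all_boot all_order all_algebra.
From mathcomp Require Import all_classical all_reals all_analysis.
From mathcomp Require Import measurable_realfun ring lra.
Import Order.TTheory GRing.Theory Num.Theory.
Import numFieldNormedType.Exports.

Local Open Scope classical_set_scope.
Local Open Scope ring_scope.

(** For [0 < h <= 1], convexity bounds the difference quotient of [f] at [a] in the direction
    [b - a] by [f b - f a]. The bound survives the limit from the right, which equals the two-sided
    one because [f] is differentiable at [a]. *)
Lemma convex_function_tangent_le (R : realType) (f : R -> R) (a b : R) :
  convex_function (E := R^o) setT (f : R^o -> R^o) -> derivable f a 1 ->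
  f a + derive1 f a * (b - a) <= f b.
Proof.
move=> cf df.
have dif : differentiable f a by exact/derivable1_diffP.
have dv : 'D_(b - a) f a = derive1 f a * (b - a).
  rewrite derive1E !deriveE// -[in LHS](mulr1 (b - a)).
  by rewrite [_ * 1](_ : _ = (b - a) *: (1 : R))// linearZ mulrC.
have dvab : derivable f a (b - a) by exact: diff_derivable.
rewrite -lerBrDl -dv /derive cvg_at_rightE//.
apply: limr_le.
  by apply: cvgP; exact: cvg_dnbhs_at_right dvab.
near=> h.
have h0 : 0 < h by near: h; exact: nbhs_right_gt.
have h1 : h <= 1 by near: h; exact: nbhs_right_le.
have := cf (Itv01 (ltW h0) h1) b a.
rewrite !in_setT => /(_ isT isT); rewrite !convRE/= /unstable.onem => le_conv.
rewrite -ler_pdivlMl ?invr_gt0// invrK.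
rewrite [h *: (b - a) + a](_ : _ = h * b + (1 - h) * a); last first.
  by rewrite /GRing.scale/=; ring.
apply: (le_trans (lerB le_conv (lexx _))); lra.
Unshelve. all: by end_near. Qed.

Lemma is_derive_cond_risk (R : realType) (phi : R -> R) (p a : R) :
  (forall t, derivable phi t 1) ->
  is_derive a 1 (cond_risk (margin_loss phi) p)
    (p * derive1 phi a - (1 - p) * derive1 phi (- a)).
Proof.
move=> dphi.
have -> : cond_risk (margin_loss phi) p =
    p \*: phi + (1 - p) \*: (phi \o -%R).
  by apply/funext => x; rewrite cond_risk_margin.
have d1 (t : R) : is_derive t 1 phi (derive1 phi t).
  by rewrite derive1E; exact: DeriveDef.
have d2 : is_derive a 1 (phi \o -%R) (derive1 phi (- a) * (- 1)).
  exact: is_derive1_comp.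
have -> : p * derive1 phi a - (1 - p) * derive1 phi (- a) =
  p *: derive1 phi a + (1 - p) *: (derive1 phi (- a) * (- 1)).
  by rewrite mulrN1 /GRing.scale/= mulrN.
by apply: is_deriveD.
Qed.

Lemma cond_risk_minP (R : realType) (phi : R -> R) (p a : R) :
  regular_margin phi -> 0 < p < 1 ->
  (forall b, cond_risk (margin_loss phi) p a <=
             cond_risk (margin_loss phi) p b) <->
  margin_invariant phi a = p / (1 - p).
Proof.
move=> rphi /andP[p0 p1].
have dphi := regular_derivable rphi.
have p10 : 1 - p != 0 by rewrite subr_eq0 gt_eqF.
have phi'0 := regular_invariant_defined rphi a.
(* Clearing denominators turns the odds equation into the vanishing of the derivative of the
   conditional risk at [a]. *)
have -> : (margin_invariant phi a = p / (1 - p)) <->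
    p * derive1 phi a = (1 - p) * derive1 phi (- a).
  rewrite /margin_invariant; split=> [/eqP|stat].
    by rewrite eqr_div// => /eqP; rewrite mulrC => ->; rewrite mulrC.
  by apply/eqP; rewrite eqr_div// stat mulrC.
split=> [amin|stat b].
  have [_ D0] : is_derive a 1 (cond_risk (margin_loss phi) p) 0.
    (* The minimum is global, so any open interval around [a] serves for Fermat's rule. *)
    apply: (@derive1_at_min _ _ (a - 1) (a + 1)).
    - lra.
    - by move=> t _; have [] := is_derive_cond_risk _ phi p t dphi.
    - by rewrite in_itv/=; lra.
    - by move=> t _; exact: amin.
  have [_] := is_derive_cond_risk _ phi p a dphi.
  by rewrite D0 => /esym/eqP; rewrite subr_eq0 => /eqP.
have tg c d := convex_function_tangent_le _ phi c d (regular_convex rphi) (dphi c).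
rewrite !cond_risk_margin.
(* The tangent bounds at [a] and [- a] are added with weights [p] and [1 - p]; stationarity cancels
   the terms linear in [b - a]. *)
have := lerD (ler_wpM2l (ltW p0) (tg a b)) (ler_wpM2l (ltW _) (tg (- a) (- b))).
move=> /(_ (1 - p)); rewrite subr_gt0 => /(_ p1); apply: le_trans.
have -> : derive1 phi (- a) = p / (1 - p) * derive1 phi a.
  by rewrite mulrAC stat mulrAC divff ?mul1r.
by rewrite le_eqVlt; apply/orP; left; apply/eqP; field.
Qed.

Lemma margin_invariant_gt0 (R : realType) (phi : R -> R) (t : R) :
  regular_margin phi -> 0 < margin_invariant phi t.
Proof.
move=> rphi.
have : [set u : R | 0 < u] (margin_invariant phi t).
  by rewrite -(regular_invariant_range rphi); exists t.
by [].
Qed.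

Lemma margin_invariant_lt (R : realType) (phi : R -> R) :
  regular_margin phi -> {mono margin_invariant phi : s t / s < t}.
Proof.
by move=> rphi; exact/leW_mono/le_mono/(regular_invariant_increasing rphi).
Qed.

(** The map [h / (1 + h)] inverts the odds map, so bounds on the odds become bounds on the
    posterior, the form in which richness and measurability of [eta] apply. *)
Lemma lt_oddsE (R : realFieldType) (h p : R) : 0 < h -> p < 1 ->
  (h < p / (1 - p)) = (h / (1 + h) < p).
Proof.
move=> h0 p1; rewrite ltr_pdivlMr ?subr_gt0// ltr_pdivrMr ?addr_gt0//.
by apply/idP/idP; lra.
Qed.

Lemma odds_ltE (R : realFieldType) (h p : R) : 0 < h -> p < 1 ->
  (p / (1 - p) < h) = (p < h / (1 + h)).
Proof.
move=> h0 p1; rewrite ltr_pdivrMr ?subr_gt0// ltr_pdivlMr ?addr_gt0//.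
by apply/idP/idP; lra.
Qed.

Lemma bayes_optimal_invariant_le d (T : measurableType d) (R : realType)
    (PX : {measure set T -> \bar R}) (eta : T -> R) (phi psi : R -> R)
    (f : {mfun T >-> R}) :
  measurable_fun setT eta -> {ae PX, forall x, 0 < eta x < 1} ->
  (forall a b : R, 0 <= a -> a < b -> b <= 1 ->
     (0 < PX (eta @^-1` `]a, b[))%E) ->
  regular_margin phi -> regular_margin psi ->
  bayes_optimal PX eta (margin_loss phi) f ->
  bayes_optimal PX eta (margin_loss psi) f ->
  forall t, margin_invariant psi t <= margin_invariant phi t.
Proof.
move=> meta eta01 rich rphi rpsi fphi fpsi t; rewrite leNgt; apply/negP => lt_t.
set h := margin_invariant phi t in lt_t.
set k := margin_invariant psi t in lt_t.
have h0 : 0 < h by exact: margin_invariant_gt0.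
have k0 : 0 < k by exact: margin_invariant_gt0.
(* The endpoints are the posteriors with odds [h] and [k]. Richness gives the interval between them
   positive mass, whereas the rest of the proof shows its preimage [U] to be negligible. *)
have /rich : 0 <= h / (1 + h) by rewrite divr_ge0 ?addr_ge0 ?ltW.
move=> /(_ (k / (1 + k))).
rewrite ltr_pdivrMr ?addr_gt0// mulrAC ltr_pdivlMr ?addr_gt0//.
rewrite ler_pdivrMr ?addr_gt0//.
have -> : h * (1 + k) < k * (1 + h) by lra.
have -> : k <= 1 * (1 + k) by lra.
move=> /(_ isT isT).
set U := eta @^-1` _.
have mU : measurable U by rewrite -[U]setTI; exact: meta.
suff /(negligibleP _ mU) -> : PX.-negligible U by rewrite ltxx.
suff nU : {ae PX, forall x, ~ U x} by apply: negligibleS nU => x Ux; exact.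
apply: filterS3 eta01 fphi fpsi => x ex01 phi_min psi_min.
have [_ e1] := andP ex01.
have phiE := (cond_risk_minP _ _ _ _ rphi ex01).1 phi_min.
have psiE := (cond_risk_minP _ _ _ _ rpsi ex01).1 psi_min.
rewrite /U/= in_itv/= -lt_oddsE// -odds_ltE// -{1}phiE -psiE.
by rewrite !margin_invariant_lt// => /andP[/lt_trans H /H]; rewrite ltxx.
Qed.

(** Choice supplies an inverse [g] of the invariant on odds without any regularity; measurability of
    [g \o eta] is recovered from strict monotonicity of the invariant. *)
Lemma bayes_optimal_exists d (T : measurableType d) (R : realType)
    (PX : {measure set T -> \bar R}) (eta : T -> R) (phi : R -> R) :
  measurable_fun setT eta -> {ae PX, forall x, 0 < eta x < 1} ->
  regular_margin phi ->
  exists f : {mfun T >-> R}, bayes_optimal PX eta (margin_loss phi) f.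
Proof.
move=> meta eta01 rphi.
pose odds (p : R) := p / (1 - p).
have /choice[g gE] p : exists t, 0 < p < 1 -> margin_invariant phi t = odds p.
  have [/andP[p0 p1]|_] := boolP (0 < p < 1); last by exists 0.
  have : [set u : R | 0 < u] (odds p) by rewrite /= divr_gt0 ?subr_gt0.
  by rewrite -(regular_invariant_range rphi) => -[t _ <-]; exists t.
pose D := eta @^-1` `]0, 1[.
have mD : measurable D by rewrite -[D]setTI; exact: meta.
have mg : measurable_fun D (g \o eta).
  (* Open upper rays suffice: on [D], [g (eta x)] exceeds [t] exactly when the odds of [eta x]
     exceed the invariant at [t]. *)
  move=> _; apply: (measurability _ (RGenOInfty.measurableE R)) => //.
  move=> /= _ [_ [t ->] <-].
  set h := margin_invariant phi t.
  have h0 : 0 < h by exact: margin_invariant_gt0.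
  have -> : D `&` (g \o eta) @^-1` `]t, +oo[ = eta @^-1` `]h / (1 + h), 1[.
    apply/seteqP; split=> x /=; rewrite /D/= !in_itv/= andbT.
      move=> [ex01]; rewrite -(margin_invariant_lt _ _ rphi) gE//.
      by have /andP[_ e1] := ex01; rewrite lt_oddsE// e1 andbT.
    move=> /andP[he e1]; have ex01 : 0 < eta x < 1.
      by rewrite e1 andbT (le_lt_trans _ he)// divr_ge0 ?addr_ge0 ?ltW.
    by split=> //; rewrite -(margin_invariant_lt _ _ rphi) gE// lt_oddsE.
  by rewrite -[X in measurable X]setTI; exact: meta.
(* Off [D] the rule takes the default value 0, which is harmless since almost every [x] lies in
   [D]. *)
have mf : (g \o eta) \_ D \in @mfun _ _ T R.
  by rewrite inE; exact: (measurable_restrictT _ mD).1 mg.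
exists (mfun_Sub mf).
apply: filterS eta01 => x ex01; apply/cond_risk_minP => //=.
by rewrite patchE mem_set ?gE// /D/= in_itv.
Qed.

Theorem theorem2 (R : realType) (d d' : measure_display)
    (Omega : measurableType d) (T : measurableType d')
    (P : probability Omega R)
    (X : {mfun Omega >-> T}) (Y : {mfun Omega >-> bool}) (eta : T -> R)
    (eta_posterior : is_posterior P X Y eta)
    (eta_nondegenerate : {ae distribution P X, forall x, 0 < eta x < 1})
    (eta_rich : forall a b : R, 0 <= a -> a < b -> b <= 1 ->
       (0 < distribution P X (eta @^-1` `]a, b[))%E) :
  exclusivity_partition (margin_losses R)
    (bayes_optimal (distribution P X) eta)
    (invariant_index R) (margin_losses_of R) /\
  realizable (bayes_optimal (distribution P X) eta)
    (invariant_index R) (margin_losses_of R).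
Proof.
have [meta _ _] := eta_posterior.
split; first split.
(* A margin loss determines its generator through the label [true], so two cells sharing a loss have
   the same index. *)
- move=> l m _ _ [L [[phi [_ -> <-]] [psi [_ E <-]]]].
  congr margin_invariant; apply/funext => t.
  by have := congr1 (fun L : loss R => L true t) E; rewrite /margin_loss mul1r.
- move=> l _; split=> [L [phi [rphi -> _]]|[f]]; first by exists phi.
  move=> [[_ [phi [rphi -> phil]] fphi] [_ [[psi rpsi ->] ncell] fpsi]].
  (* Equality of the two invariants would put the outside loss in the cell; the one-sided
     comparison, used in both directions, yields it. *)
  apply: ncell; exists psi; split=> //; rewrite -phil; apply/funext => t.
  by apply/le_anti/andP; split; apply: bayes_optimal_invariant_le; eassumption.
- move=> _ [phi rphi <-]; exists (margin_loss phi); first by exists phi.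
  exact: bayes_optimal_exists.
Qed.
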